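(* Let $k\ge2$, $n\ge1$, $A=\{0<1<\cdots<k-1\}$, let $\alpha=0\,1\,2\cdots(k-1)\in A^{k}$ and $v=\alpha^{k^{n-1}}$. Let $M$ be the unique multiset of necklaces with $BW(M)=v$, and let $T=T(M)$ be its table. Then $T$ has exactly $n$ columns and its rows, from top to bottom, are the $n$-digit base-$k$ representations of $0,1,\dots,k^{n}-1$ in increasing order. Moreover $M$ is the set of necklaces of all Lyndon words over $A$ whose length divides $n$, and the rows of $T$ whose roots are Lyndon words occur in $T$ in lexicographic order.
   Context: Words are compared lexicographically (a proper prefix precedes the longer word). A word is primitive if it is not a proper power of another word; the root of a word $w$ is the shortest $r$ with $w=r^{t}$, $t\ge1$. A necklace is the set of conjugates ($xy\sim yx$) of a primitive word; its Lyndon word is its lexicographically least element. For a finite multiset $M$ of necklaces, with $l$ the lcm of their lengths, the table $T(M)$ is the lexicographically sorted list (as rows) of all words $u^{l/|u|}$, $u$ ranging over the words of each necklace of $M$ (with multiplicity), and $BW(M)$ is the last column of $T(M)$ read from top to bottom. It is known that $BW$ is a bijection from finite multisets of necklaces over $A$ onto $A^{*}$. *)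

(* Defs.v *)
From mathcomp Require Import all_boot.
Set Implicit Arguments. Unset Strict Implicit. Unset Printing Implicit Defensive.

Fixpoint lexle (s t : seq nat) : bool :=
  match s, t with
  | [::], _ => true
  | _ :: _, [::] => false
  | a :: s', b :: t' => (a < b) || ((a == b) && lexle s' t')
  end.

Definition wle (k : nat) (u w : seq 'I_k) : bool := lexle (map val u) (map val w).
Definition wlt (k : nat) (u w : seq 'I_k) : bool := wle u w && (u != w).

Definition wpow (T : Type) (w : seq T) (t : nat) : seq T := flatten (nseq t w).

Definition primitive (k : nat) (w : seq 'I_k) : Prop :=
  ~ exists (r : seq 'I_k) (t : nat), 1 < t /\ w = wpow r t.

(* root: the shortest r with w = r^t, t >= 1 (r is necessarily a prefix of w) *)
Definition wroot_len (k : nat) (w : seq 'I_k) : nat :=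
  find (fun d => (0 < d) && (d %| size w) && (w == wpow (take d w) (size w %/ d)))
       (iota 0 (size w).+1).
Definition wroot (k : nat) (w : seq 'I_k) : seq 'I_k := take (wroot_len w) w.

(* The necklace (set of conjugates) of w, represented canonically as the
   lexicographically sorted duplicate-free list of its conjugates rot i w. *)
Definition necklace (k : nat) (w : seq 'I_k) : seq (seq 'I_k) :=
  sort (@wle k) (undup [seq rot i w | i <- iota 0 (size w)]).

Definition is_necklace (k : nat) (N : seq (seq 'I_k)) : Prop :=
  exists w, primitive w /\ N = necklace w.

(* A finite multiset of necklaces is a list of necklaces (up to permutation). *)
Definition is_necklace_multiset (k : nat) (M : seq (seq (seq 'I_k))) : Prop :=
  forall N, N \in M -> is_necklace N.

Definition lyndon (k : nat) (w : seq 'I_k) : Prop :=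
  primitive w /\ forall u, u \in necklace w -> wle w u.

Definition necklace_len (k : nat) (N : seq (seq 'I_k)) : nat := size (head [::] N).
Definition lcm_len (k : nat) (M : seq (seq (seq 'I_k))) : nat :=
  foldr lcmn 1 [seq necklace_len N | N <- M].

Definition table (k : nat) (M : seq (seq (seq 'I_k))) : seq (seq 'I_k) :=
  let l := lcm_len M in
  sort (@wle k) (flatten [seq [seq wpow u (l %/ size u) | u <- N] | N <- M]).

Definition BW (k : nat) (M : seq (seq (seq 'I_k))) : seq 'I_k :=
  flatten [seq drop (size r).-1 r | r <- table M].

Definition alpha (k : nat) : seq 'I_k := enum 'I_k.

Definition digits (k n i : nat) : seq nat :=
  [seq (i %/ k ^ (n - 1 - j)) %% k | j <- iota 0 n].

(* Main.v *)
(* The rows of a table are closed under rotation, so moving its last column to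
   the front only permutes the rows. Hence the first [j+1] columns are the sorted
   rearrangement of the last column glued to the first [j] columns, and the last
   column determines the first columns one after the other. The list of all words
   of length [n] in increasing order is sorted, closed under rotation and has last
   column [v], so its first [min l n] columns agree with those of the table, [l]
   being the number of columns of the table. If [l < n], the last letter of every
   word of length [n] would be a function of its first [l] letters, which fails for
   [0...01]. If [l >= n], the last letter of each row equals its [n]-th letter;
   by rotation each row has cyclic period [n], so the length of every necklace
   divides [n] and [l = n]. *)
Require Import Defs.
From mathcomp Require Import all_boot.
Set Implicit Arguments. Unset Strict Implicit. Unset Printing Implicit Defensive.

(** * The lexicographic order on words *)

Lemma lexle_refl : reflexive lexle.
Proof. by elim=> //= a s ->; rewrite eqxx orbT. Qed.

Lemma lexle_total : total lexle.
Proof.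
elim=> [|a s IHs] [|b t] //=; rewrite (eq_sym b a).
by case: (ltngtP a b) => //= _; exact: IHs.
Qed.

Lemma lexle_anti : antisymmetric lexle.
Proof.
elim=> [|a s IHs] [|b t] //=; rewrite (eq_sym b a).
by case: (ltngtP a b) => //= -> /IHs ->.
Qed.

Lemma lexle_trans : transitive lexle.
Proof.
move=> t s u; elim: s t u => [|a s IHs] [|b t] [|c u] //=.
case/orP=> [ltab|/andP[/eqP <- st]] /orP[ltbc|/andP[/eqP <- tu]].
- by rewrite (ltn_trans ltab ltbc).
- by rewrite ltab.
- by rewrite ltbc.
- by rewrite eqxx (IHs t) ?orbT.
Qed.

Lemma lexle_take j s t : lexle s t -> lexle (take j s) (take j t).
Proof.
elim: j s t => [|j IHj] [|a s] [|b t] //=.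
by case/orP=> [->//|/andP[-> /IHj ->]]; rewrite orbT.
Qed.

Lemma lexle_cat s t s' t' : size s = size t ->
  lexle s t -> lexle s' t' -> lexle (s ++ s') (t ++ t').
Proof.
elim: s t => [|a s IHs] [|b t] //= [sz] /orP[->//|/andP[-> st] st'].
by rewrite IHs ?orbT.
Qed.

Section Order.
Variable k : nat.
Implicit Types u v w x y z : seq 'I_k.

Lemma wle_refl : reflexive (@wle k). Proof. by move=> u; exact: lexle_refl. Qed.
Lemma wle_total : total (@wle k). Proof. by move=> u w; exact: lexle_total. Qed.
Lemma wle_trans : transitive (@wle k).
Proof. by move=> u w z; exact: lexle_trans. Qed.
Lemma wle_anti : antisymmetric (@wle k).
Proof. by move=> u w /lexle_anti/(inj_map val_inj). Qed.

Lemma wle_take j u w : wle u w -> wle (take j u) (take j w).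
Proof. by rewrite /wle !map_take; exact: lexle_take. Qed.

Lemma wle_cat u w u' w' : size u = size w ->
  wle u w -> wle u' w' -> wle (u ++ u') (w ++ w').
Proof. by move=> sz; rewrite /wle !map_cat; apply: lexle_cat; rewrite !size_map. Qed.

Lemma wle_take_id j u : wle (take j u) u.
Proof.
rewrite /wle map_take; elim: (map val u) j => [|a s IHs] [|j] //=.
by rewrite eqxx IHs orbT.
Qed.

Lemma wsorted_perm_eq (S T : seq (seq 'I_k)) :
  sorted (@wle k) S -> sorted (@wle k) T -> perm_eq S T -> S = T.
Proof. by apply: sorted_eq; [exact: wle_trans | exact: wle_anti]. Qed.

End Order.

(** * Powers of words, rotations and periods *)

Section Powers.
Variable T : Type.
Implicit Types u w : seq T.

Lemma wpowS w t : wpow w t.+1 = w ++ wpow w t. Proof. by []. Qed.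

Lemma wpow1 w : wpow w 1 = w. Proof. exact: cats0. Qed.

Lemma wpowD w s t : wpow w (s + t) = wpow w s ++ wpow w t.
Proof. by rewrite /wpow nseqD flatten_cat. Qed.

Lemma size_wpow w t : size (wpow w t) = t * size w.
Proof. by elim: t => // t IHt; rewrite wpowS size_cat IHt mulSn. Qed.

Lemma wpowM w s t : wpow w (s * t) = wpow (wpow w t) s.
Proof. by elim: s => // s IHs; rewrite mulSn wpowD IHs. Qed.

Lemma rot1_wpow w t : rot 1 (wpow w t) = wpow (rot 1 w) t.
Proof.
case: w => [|a w]; first by elim: t => // t; rewrite wpowS.
case: t => // t; rewrite wpowS cat_cons !rot1_cons -cats1 -catA.
suff E m : wpow (a :: w) m ++ [:: a] = a :: wpow (w ++ [:: a]) m.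
  by rewrite -cats1 E wpowS -catA.
by elim: m => // m IHm; rewrite wpowS -catA IHm wpowS /= -catA.
Qed.

Lemma iter_rot_wpow m w t :
  iter m (rot 1) (wpow w t) = wpow (iter m (rot 1) w) t.
Proof. by elim: m => //= m ->; rewrite rot1_wpow. Qed.

Lemma size_iter_rot m w : size (iter m (rot 1) w) = size w.
Proof. by elim: m => //= m; rewrite size_rot. Qed.

Lemma iter_rotE m w : m <= size w -> iter m (rot 1) w = rot m w.
Proof.
elim: m => [|m IHm] lt_m /=; first by rewrite rot0.
by rewrite IHm ?(ltnW lt_m) // -rotD // add1n.
Qed.

Lemma iter_rot_size w : iter (size w) (rot 1) w = w.
Proof. by rewrite iter_rotE // rot_size. Qed.

Lemma iter_rot_mul c d w : iter d (rot 1) w = w -> iter (c * d) (rot 1) w = w.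
Proof. by move=> Ed; elim: c => // c IHc; rewrite mulSn iterD IHc. Qed.

Lemma iter_rot_mod m w : iter m (rot 1) w = iter (m %% size w) (rot 1) w.
Proof.
by rewrite {1}(divn_eq m (size w)) addnC iterD iter_rot_mul // iter_rot_size.
Qed.

(** By Bezout, [gcdn d e + a * e] is a multiple of [d] for some [a]. Rotating by this number fixes
    [w], and so does its part [a * e]. *)
Lemma iter_rot_gcd d e w : iter d (rot 1) w = w -> iter e (rot 1) w = w ->
  iter (gcdn d e) (rot 1) w = w.
Proof.
case: (posnP d) => [-> _|d_gt0 Ed Ee]; first by rewrite gcd0n.
have [a _ /dvdnP[c Ec]] := Bezoutl e d_gt0.
by rewrite -{1}(iter_rot_mul a Ee) -iterD Ec iter_rot_mul.
Qed.

(** Comparing the prefixes of length [size u] shows that [w] starts with [u]; cancelling this [u]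
    leaves a shorter word that still commutes with [u]. *)
Lemma commuting_wpow c u w : u ++ w = w ++ u -> size w = c * size u -> w = wpow u c.
Proof.
elim: c w => [|c IHc] w Ec; first by move/size0nil.
rewrite mulSn => sz_w.
have lesz : size u <= size w by rewrite sz_w leq_addr.
have Ew : w = u ++ drop (size u) w.
  rewrite -{1}(cat_take_drop (size u) w); congr (_ ++ _).
  by move/(congr1 (take (size u))): Ec; rewrite take_size_cat // takel_cat.
rewrite Ew wpowS; congr (_ ++ _); apply: IHc.
  move: Ec; rewrite Ew -catA => /(congr1 (drop (size u))).
  by rewrite !drop_size_cat.
by rewrite size_drop sz_w addKn.
Qed.

(** Cut [w] after [g] letters: invariance under rotation by [g] says exactly that the two pieces
    commute. *)
Lemma period_wpow g w : 0 < g -> g %| size w -> iter g (rot 1) w = w ->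
  w = wpow (take g w) (size w %/ g).
Proof.
move=> g_gt0 /dvdnP[[|c] Ew]; first by rewrite (size0nil Ew) div0n.
have leg : g <= size w by rewrite Ew mulSn leq_addr.
have sz_t : size (take g w) = g by rewrite size_takel.
rewrite iter_rotE // Ew mulnK // wpowS /rot => Erot.
rewrite -{1}(cat_take_drop g w); congr (_ ++ _).
apply: commuting_wpow; first by rewrite Erot cat_take_drop.
by rewrite sz_t size_drop Ew mulSn addKn.
Qed.

Lemma wpow_inj_size u w s t : size u = size w -> 0 < s -> 
  wpow u s = wpow w t -> u = w.
Proof.
case: s t => // s [|t] sz _; last first.
  by rewrite !wpowS => /(congr1 (take (size u))); rewrite take_size_cat // sz take_size_cat.
(* The exponent on the right is 0, so by lengths both [u] and [w] are empty. *)
move/(congr1 size); rewrite !size_wpow mul0n => /eqP.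
rewrite muln_eq0 /= => /eqP u0; move: (sz); rewrite u0 => /esym/size0nil ->.
exact: size0nil.
Qed.

End Powers.

(** * Primitive words, necklaces, roots and Lyndon words *)

Section Primitive.
Variable k : nat.
Implicit Types u v w x y z : seq 'I_k.

Lemma primitive_gt0 w : primitive w -> 0 < size w.
Proof. by case: w => // prim_w; case: prim_w; exists [::], 2. Qed.

(** The gcd of [size w] and [g] is again a period, now one dividing the length. If it were smaller
    than [size w], then [w] would be a proper power. *)
Lemma primitive_dvdn w g : primitive w -> iter g (rot 1) w = w -> size w %| g.
Proof.
move=> prim_w Eg; have w_gt0 := primitive_gt0 prim_w.
have := iter_rot_gcd (iter_rot_size w) Eg.
set d := gcdn _ _ => Ed.
have d_gt0 : 0 < d by rewrite gcdn_gt0 w_gt0.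
have dw : d %| size w by rewrite dvdn_gcdl.
suff -> : size w = d by rewrite dvdn_gcdr.
have [q_gt1|q_le1] := ltnP 1 (size w %/ d).
  by case: prim_w; exists (take d w), (size w %/ d); split=> //; apply: period_wpow.
rewrite -{1}(divnK dw).
suff -> : size w %/ d = 1 by rewrite mul1n.
by apply/eqP; rewrite eqn_leq q_le1 divn_gt0 // dvdn_leq.
Qed.

Lemma dvdn_primitive w : 0 < size w ->
  (forall g, iter g (rot 1) w = w -> size w %| g) -> primitive w.
Proof.
move=> w_gt0 dvd_w [r [t [t_gt1 Ew]]].
have Er : iter (size r) (rot 1) w = w.
  by rewrite Ew iter_rot_wpow iter_rot_size.
move: (w_gt0) (dvd_w _ Er); rewrite {1 2}Ew size_wpow muln_gt0 => /andP[_ r_gt0].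
move/(dvdn_leq r_gt0); rewrite -{2}(mul1n (size r)) leq_pmul2r //.
by rewrite leqNgt t_gt1.
Qed.

Lemma primitive_iter_rot m w : primitive w -> primitive (iter m (rot 1) w).
Proof.
move=> prim_w; apply: dvdn_primitive; rewrite size_iter_rot; first exact: primitive_gt0.
move=> g; rewrite -iterD addnC iterD => Eg; apply: primitive_dvdn => //.
by elim: m Eg => // m IHm /= /rot_inj.
Qed.

Lemma primitive_dvdn_wpow u t g : primitive u -> 0 < t ->
  iter g (rot 1) (wpow u t) = wpow u t -> size u %| g.
Proof.
move=> prim_u t_gt0; rewrite iter_rot_wpow => /wpow_inj_size E.
by apply: primitive_dvdn => //; apply: E => //; rewrite size_iter_rot.
Qed.

(** The common power is fixed by rotation by [size u] and by [size w], so each length divides the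
    other; prefixes of equal length then agree. *)
Lemma primitive_root_uniq u w s t : primitive u -> primitive w -> 0 < s -> 0 < t ->
  wpow u s = wpow w t -> u = w.
Proof.
move=> prim_u prim_w s_gt0 t_gt0 E; apply: wpow_inj_size (E) => //.
apply/eqP; rewrite eqn_dvd (primitive_dvdn_wpow prim_u s_gt0) ?(primitive_dvdn_wpow prim_w t_gt0) //.
  by rewrite -E iter_rot_wpow iter_rot_size.
by rewrite E iter_rot_wpow iter_rot_size.
Qed.

Lemma mem_necklace u w : 0 < size w ->
  reflect (exists m, u = iter m (rot 1) w) (u \in necklace w).
Proof.
move=> w_gt0; rewrite mem_sort mem_undup; apply: (iffP mapP) => [[i]|[m ->]].
  by rewrite mem_iota add0n => /andP[_ /ltnW lei] ->; exists i; rewrite iter_rotE.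
have ltm : m %% size w < size w by rewrite ltn_mod.
exists (m %% size w); first by rewrite mem_iota.
by rewrite -iter_rotE 1?ltnW // -iter_rot_mod.
Qed.

Lemma necklace_id w : 0 < size w -> w \in necklace w.
Proof. by move=> w_gt0; apply/mem_necklace=> //; exists 0. Qed.

Lemma size_mem_necklace u w : 0 < size w -> u \in necklace w -> size u = size w.
Proof. by move=> w_gt0 /mem_necklace[//|m ->]; rewrite size_iter_rot. Qed.

Lemma primitive_mem_necklace u w : primitive w -> u \in necklace w -> primitive u.
Proof.
move=> prim_w /mem_necklace[|m ->]; first exact: primitive_gt0.
exact: primitive_iter_rot.
Qed.

Lemma necklace_uniq w : uniq (necklace w).
Proof. by rewrite sort_uniq undup_uniq. Qed.

Lemma iter_rot_cancel m w : exists m', w = iter m' (rot 1) (iter m (rot 1) w).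
Proof.
(* With the [m] rotations already made, the total is [m * size w], a number of full turns. *)
exists (m * (size w).-1); rewrite -iterD.
case: (posnP (size w)) => [/size0nil ->|w_gt0]; first by elim: (_ + m) => //= ? <-.
by rewrite addnC -mulnS prednK // iter_rot_mul // iter_rot_size.
Qed.

Lemma necklace_eq u w : 0 < size w -> u \in necklace w -> necklace u = necklace w.
Proof.
move=> w_gt0 uw; have sz_u := size_mem_necklace w_gt0 uw.
have u_gt0 : 0 < size u by rewrite sz_u.
apply: wsorted_perm_eq; try by apply: sort_sorted; exact: wle_total.
apply: uniq_perm; try exact: necklace_uniq.
case/(mem_necklace u w_gt0): uw => m Eu y; have [m' Ew] := iter_rot_cancel m w.
apply/mem_necklace/mem_necklace => // -[i ->].
  by exists (i + m); rewrite iterD -Eu.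
by exists (i + m'); rewrite iterD Eu -Ew.
Qed.

(** Rotation is an injective map of this finite set into itself, hence permutes it. *)
Lemma necklace_rot w : perm_eq (map (rot 1) (necklace w)) (necklace w).
Proof.
case: (posnP (size w)) => [/size0nil ->|w_gt0]; first by [].
have un : uniq (map (rot 1) (necklace w)).
  by rewrite map_inj_uniq ?necklace_uniq //; exact: rot_inj.
apply: uniq_perm => //; first exact: necklace_uniq.
have [||_ //] := uniq_min_size un (s2 := necklace w); last by rewrite size_map.
move=> _ /mapP[u /(mem_necklace _ w_gt0)[m ->] ->].
by apply/mem_necklace => //; exists m.+1.
Qed.

Lemma wroot_spec x : 0 < size x ->
  [/\ 0 < size (wroot x), size (wroot x) %| size x,
      x = wpow (wroot x) (size x %/ size (wroot x)) & primitive (wroot x)].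
Proof.
move=> x_gt0; pose P d := (0 < d) && (d %| size x) && (x == wpow (take d x) (size x %/ d)).
have hasP : has P (iota 0 (size x).+1).
  apply/hasP; exists (size x); first by rewrite mem_iota add0n ltnSn.
  by rewrite /P x_gt0 dvdnn divnn x_gt0 take_size wpow1 eqxx.
have ltd : wroot_len x < (size x).+1 by move: hasP; rewrite has_find size_iota.
have := nth_find 0 hasP; rewrite -/(wroot_len x) nth_iota // add0n => /andP[/andP[d_gt0 dx] /eqP Ex].
have sz : size (wroot x) = wroot_len x by rewrite size_takel.
rewrite !sz; split=> //; move=> [r [t [t_gt1 Er]]].
have sz_r : wroot_len x = t * size r by rewrite -sz Er size_wpow.
have r_gt0 : 0 < size r by move: d_gt0; rewrite sz_r muln_gt0 => /andP[].
have ltr : size r < wroot_len x by rewrite sz_r ltn_Pmull.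
(* If the root were [r ^ t] with [t > 1], then [x] would be a power of [r], and [size r] would
   satisfy [P] before the index that [find] returns. Entries of [iota 0 _] equal their indices, so
   that index is itself a length. *)
have := @before_find _ 0 P (iota 0 (size x).+1) _ ltr.
rewrite nth_iota ?(ltn_trans ltr) // add0n /P r_gt0 /=.
have rx : size r %| size x by apply: dvdn_trans dx; rewrite sz_r dvdn_mull.
rewrite rx; suff -> : take (size r) x = r.
  rewrite {1}Ex -/(wroot x) Er -wpowM.
  suff -> : size x %/ wroot_len x * t = size x %/ size r by rewrite eqxx.
  by rewrite -{2}(divnK dx) sz_r mulnA mulnK.
have -> : take (size r) x = take (size r) (wroot x) by rewrite take_takel 1?ltnW.
by rewrite Er; case: (t) t_gt1 => // t' _; rewrite wpowS take_size_cat.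
Qed.

Lemma wroot_wpow u t : primitive u -> 0 < t -> wroot (wpow u t) = u.
Proof.
move=> prim_u t_gt0; have u_gt0 := primitive_gt0 prim_u.
have x_gt0 : 0 < size (wpow u t) by rewrite size_wpow muln_gt0 t_gt0.
have [r_gt0 rx Ex prim_r] := wroot_spec x_gt0.
apply: (primitive_root_uniq prim_r prim_u _ t_gt0 (esym Ex)).
by rewrite divn_gt0 // dvdn_leq.
Qed.

Lemma lyndon_conjugate w : primitive w -> exists2 u, u \in necklace w & lyndon u.
Proof.
move=> prim_w; have w_gt0 := primitive_gt0 prim_w.
have := necklace_id w_gt0; have := sort_sorted (@wle_total k) (undup [seq rot i w | i <- iota 0 (size w)]).
rewrite -/(necklace w); case EN: (necklace w) => [//|u N] srt _.
have uN : u \in necklace w by rewrite EN mem_head.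
exists u; first by rewrite -EN.
split; first exact: primitive_mem_necklace uN.
move=> y; rewrite (necklace_eq w_gt0 uN) EN inE => /predU1P[-> | yN]; first exact: wle_refl.
exact: (allP (order_path_min (@wle_trans k) srt)).
Qed.

Lemma wle_wpow t u w : size u = size w -> wle u w -> wle (wpow u t) (wpow w t).
Proof.
by move=> sz le_uw; elim: t => [|t IHt]; [exact: wle_refl | apply: wle_cat].
Qed.

(* Each block of [x] at a position divisible by [size w] is the prefix of a
   rotation of [x], hence at least [w]. *)
Lemma wle_wpow_min_rot b w x : size x = b * size w ->
  (forall m, wle x (iter m (rot 1) x)) -> wle w x -> wle (wpow w b) x.
Proof.
move=> sz_x min_x le_wx.
suff H c z y : x = z ++ y -> size y = c * size w -> wle (wpow w c) y.
  exact: (H b [::]).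
elim: c z y => [|c IHc] z y Ex; first by rewrite /wle.
rewrite mulSn => sz_y.
have le_wy : wle w (take (size w) y).
  have := wle_trans le_wx (min_x (size z)); rewrite iter_rotE; last first.
    by rewrite Ex size_cat leq_addr.
  rewrite {1}Ex rot_size_cat => /(wle_take (size w)).
  by rewrite take_size takel_cat // sz_y leq_addr.
rewrite wpowS -[y](cat_take_drop (size w)).
apply: wle_cat => //; first by rewrite size_takel // sz_y leq_addr.
apply: (IHc (z ++ take (size w) y)); first by rewrite -catA cat_take_drop.
by rewrite size_drop sz_y addKn.
Qed.

(** Suppose [w] is at most [u]. The power of [u] is least among its rotations because [u] is Lyndon,
    and it is at least its prefix [u], hence at least [w]. So it is at least the power of [w] of the
    same length, against the assumed strict inequality. *)
Lemma lyndon_wpow_lt u w t s : lyndon u -> lyndon w ->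
  size (wpow u t.+1) = size (wpow w s) ->
  wlt (wpow u t.+1) (wpow w s) -> wlt u w.
Proof.
move=> [prim_u min_u] _ sz /andP[le_uw ne_uw].
have u_gt0 := primitive_gt0 prim_u.
have u_w : u != w.
  apply: contraNneq ne_uw => Euw; move/eqP: sz.
  by rewrite !size_wpow -Euw eqn_pmul2r // => /eqP ->.
rewrite /wlt u_w andbT; case/orP: (wle_total u w) => // le_wu.
case/negP: ne_uw; apply/eqP/wle_anti; rewrite le_uw /=.
apply: wle_wpow_min_rot; first by rewrite sz size_wpow.
  move=> m; rewrite iter_rot_wpow; apply: wle_wpow; first by rewrite size_iter_rot.
  by apply: min_u; apply/mem_necklace => //; exists m.
apply: (wle_trans le_wu); rewrite -{1}(take_size_cat (wpow u t) (erefl (size u))).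
exact: wle_take_id.
Qed.

End Primitive.

(** * The sorted list of all words of a given length, and base-k digits *)

Fixpoint words k n : seq (seq 'I_k) :=
  if n is n'.+1 then [seq a :: w | a <- enum 'I_k, w <- words k n'] else [:: [::]].

Section Words.
Variable k : nat.

Lemma mem_words n (w : seq 'I_k) : (w \in words k n) = (size w == n).
Proof.
elim: n w => [|n IHn] [|a w] //=; first by apply/allpairsP => -[[b y] []].
rewrite eqSS -IHn; apply/allpairsP/idP => [[[b y] /= [_ yn [_ ->]]] //|wn].
by exists (a, w); rewrite mem_enum.
Qed.

Lemma words_uniq n : uniq (words k n).
Proof.
elim: n => //= n IHn; apply: allpairs_uniq => //; first exact: enum_uniq.
by move=> [a w] [b y] _ _ /= [-> ->].
Qed.

Lemma words_sorted n : sorted (@wle k) (words k n).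
Proof.
(* The pairwise form splits over the concatenation of the blocks, one for each first letter. *)
rewrite (sorted_pairwise (@wle_trans k)).
elim: n => //= n IHn.
have: pairwise (fun a b : 'I_k => a < b) (enum 'I_k).
  rewrite -(sorted_pairwise (fun b a c : 'I_k => @ltn_trans b a c)).
  by rewrite -(sorted_map (f := val) (e' := ltn)) val_enum_ord iota_ltn_sorted.
elim: (enum 'I_k) => //= a s IHs /andP[a_lt /IHs srt_s].
rewrite pairwise_cat srt_s andbT pairwise_map; apply/andP; split; last first.
  by apply: sub_pairwise IHn => u w /=; rewrite /wle /= eqxx => ->; rewrite orbT.
apply/allrelP => _ _ /mapP[u _ ->] /allpairsP[[b w] /= [bs _ ->]].
by rewrite /wle /= (allP a_lt b bs).
Qed.

(** Prepending a letter to a nonempty word keeps its last letter. So each of the [k] blocks of words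
    with a common first letter repeats the last column of the words one letter shorter. *)
Lemma map_last_words (x0 : 'I_k) n :
  map (last x0) (words k n.+1) = wpow (alpha k) (k ^ n).
Proof.
elim: n => [|n IHn].
  by rewrite wpow1 /alpha /= allpairs1r -map_comp -[RHS]map_id; apply: eq_map.
rewrite expnS wpowM -IHn.
have: forall w, w \in words k n.+1 -> 0 < size w by move=> w; rewrite mem_words => /eqP->.
have -> : words k n.+2 = [seq a :: w | a <- enum 'I_k, w <- words k n.+1] by [].
move: (words k n.+1) => W W_gt0; rewrite map_flatten -map_comp /wpow; congr flatten.
transitivity (nseq (size (enum 'I_k)) (map (last x0) W)); last by rewrite size_enum_ord.
elim: (enum 'I_k) => // a s IHs; congr (_ :: _); last exact: IHs.
by rewrite /= -map_comp; apply/eq_in_map => -[|b w] // /W_gt0.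
Qed.

Lemma words_rot n : perm_eq (map (rot 1) (words k n)) (words k n).
Proof.
have un : uniq (map (rot 1) (words k n)).
  by rewrite map_inj_uniq ?words_uniq //; exact: rot_inj.
apply: uniq_perm => //; first exact: words_uniq.
have [||_ //] := uniq_min_size un (s2 := words k n); last by rewrite size_map.
by move=> _ /mapP[u un' ->]; rewrite mem_words size_rot -mem_words.
Qed.

(** Division with remainder by [d], in the order in which [words] lists first letter and tail. *)
Lemma iota_mul m d : iota 0 (m * d) = [seq a * d + i | a <- iota 0 m, i <- iota 0 d].
Proof.
elim: m => // m IHm; rewrite mulSnr iotaD IHm -[in RHS]addn1 iotaD allpairs_cat.
by congr (_ ++ _); rewrite /= cats0 add0n -{1}(addn0 (m * d)) iotaDl.
Qed.

Lemma digitsS n a i : a < k -> i < k ^ n ->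
  digits k n.+1 (a * k ^ n + i) = a :: digits k n i.
Proof.
move=> lt_ak lt_i; have k_gt0 : 0 < k by apply: leq_ltn_trans lt_ak.
have kX_gt0 e : 0 < k ^ e by rewrite expn_gt0 k_gt0.
rewrite /digits /= subSS !subn0 divnMDl // (divn_small lt_i) addn0 modn_small //.
congr (_ :: _); rewrite -[1]addn0 iotaDl -map_comp.
apply/eq_in_map => j; rewrite mem_iota => /andP[_ lt_jn] /=.
have -> : n - (1 + j) = n - 1 - j by rewrite subnDA.
(* [e] is the weight of the digit. Since [e < n], dividing [a * k ^ n] by [k ^ e] leaves a multiple
   of [k], so the leading term does not affect this digit. *)
set e := n - 1 - j; have -> : n = j + 1 + e by rewrite /e -subnDA [1 + j]addnC subnKC // addn1.
by rewrite expnD mulnA divnMDl // expnD expn1 mulnA modnMDl.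
Qed.

Lemma map_val_words n :
  [seq map val w | w <- words k n] = [seq digits k n i | i <- iota 0 (k ^ n)].
Proof.
elim: n => //= n IHn; rewrite expnS iota_mul !map_allpairs.
transitivity [seq a :: digits k n i | a <- iota 0 k, i <- iota 0 (k ^ n)]; last first.
  by apply/eq_in_allpairs => a i; rewrite !mem_iota => lt_ak lt_i; rewrite -digitsS.
by rewrite -(allpairs_mapr (fun=> cons _)) -IHn -val_enum_ord allpairs_mapl allpairs_mapr.
Qed.

End Words.

(** * Tables of multisets of necklaces and their columns *)

Section Tables.
Variable k : nat.
Implicit Types (u w r : seq 'I_k) (M : seq (seq (seq 'I_k))) (T W : seq (seq 'I_k)).

Lemma flatten_last (x0 : 'I_k) T : (forall r, r \in T -> 0 < size r) ->
  flatten [seq drop (size r).-1 r | r <- T] = map (last x0) T.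
Proof.
move=> T_gt0; rewrite -[RHS]flatten_map1; congr flatten.
apply/eq_in_map => r /T_gt0; case/lastP: r => // r a _ /=.
by rewrite last_rcons size_rcons /= -cats1 drop_size_cat.
Qed.

Lemma perm_columnsS (x0 : 'I_k) T l j : (forall r, r \in T -> size r = l) ->
  perm_eq (map (rot 1) T) T -> j < l ->
  perm_eq (map (take j.+1) T)
          [seq p.1 :: p.2 | p <- zip (map (last x0) T) (map (take j) T)].
Proof.
move=> sz_T rot_T lt_jl; rewrite zip_map -map_comp.
have /(perm_map (rotr 1)) := rot_T.
rewrite mapK; last exact: rotK.
move/(perm_map (take j.+1)) => perm_T; apply: (perm_trans perm_T).
rewrite -map_comp; apply: (eq_ind _ (perm_eq _) (perm_refl _)).
apply/eq_in_map => r /sz_T; case/lastP: r => [|r a] /=; first by move=> l0; rewrite -l0 in lt_jl.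
rewrite size_rcons rotr1_rcons last_rcons => sz_r /=.
(* As [j < l], the first [j] letters of the row do not reach its last letter. *)
by rewrite -cats1 takel_cat // -ltnS sz_r.
Qed.

(** Truncating rows keeps them sorted, and sorted lists that are permutations of each other are
    equal. The row lengths [l] and [n] may differ, since the number of columns of the table is not
    known beforehand. *)
Lemma columns_determined (x0 : 'I_k) T W l n j :
  (forall r, r \in T -> size r = l) -> (forall r, r \in W -> size r = n) ->
  perm_eq (map (rot 1) T) T -> perm_eq (map (rot 1) W) W ->
  sorted (@wle k) T -> sorted (@wle k) W ->
  map (last x0) T = map (last x0) W ->
  j <= l -> j <= n -> map (take j) T = map (take j) W.
Proof.
move=> sz_T sz_W rot_T rot_W srt_T srt_W eqL.
have srt S i : sorted (@wle k) S -> sorted (@wle k) (map (take i) S).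
  by apply: homo_sorted => u w; exact: wle_take.
elim: j => [_ _|j IHj ltl ltn].
  have sizeE: size T = size W by move/(congr1 size): eqL; rewrite !size_map.
  have take0E S : map (take 0) S = nseq (size S) ([::] : seq 'I_k).
    by elim: S => //= r S ->; rewrite take0.
  by rewrite !take0E sizeE.
apply: wsorted_perm_eq; [exact: srt | exact: srt |].
apply: perm_trans (perm_columnsS x0 sz_T rot_T ltl) _.
by rewrite eqL IHj 1?ltnW // perm_sym; exact: perm_columnsS sz_W rot_W ltn.
Qed.

Lemma nth_iter_rot (x0 : 'I_k) m r i : i < size r ->
  nth x0 (iter m (rot 1) r) i = nth x0 r ((i + m) %% size r).
Proof.
elim: m i => [|m IHm] i lt_i; first by rewrite addn0 modn_small.
have r_gt0 : 0 < size r by apply: leq_ltn_trans lt_i.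
have rot1E s : i < size s -> nth x0 (rot 1 s) i = nth x0 s (i.+1 %% size s).
  case: s => // a s; rewrite rot1_cons nth_rcons /= ltnS leq_eqVlt.
  case: (ltngtP i (size s)) => //= [lti _|-> _]; last by rewrite modnn.
  by rewrite modn_small.
rewrite iterS rot1E size_iter_rot // IHm ?ltn_mod //.
by rewrite modnDml addSnnS.
Qed.

Lemma mem_multiset M N u : is_necklace_multiset M -> N \in M -> u \in N ->
  [/\ primitive u, N = necklace u, necklace_len N = size u & size u %| lcm_len M].
Proof.
move=> ndM NM; have [w [prim_w EN]] := ndM N NM; rewrite EN => uw.
have w_gt0 := primitive_gt0 prim_w; have prim_u := primitive_mem_necklace prim_w uw.
have len : necklace_len (necklace w) = size u.
  rewrite (size_mem_necklace w_gt0 uw) /necklace_len.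
  have : head [::] (necklace w) \in necklace w by case: (necklace w) uw => // *; exact: mem_head.
  exact: size_mem_necklace.
rewrite (necklace_eq w_gt0 uw); split=> //; rewrite -len -EN.
elim: M NM {ndM} => //= N' M IHM; rewrite inE => /predU1P[-> | /IHM]; first exact: dvdn_lcml.
by move/dvdn_trans; apply; exact: dvdn_lcmr.
Qed.

Lemma multiset_inhabited M N : is_necklace_multiset M -> N \in M -> exists u, u \in N.
Proof.
by move=> ndM /ndM[w [/primitive_gt0 w_gt0 ->]]; exists w; exact: necklace_id.
Qed.

Lemma lcm_len_dvdn M n : is_necklace_multiset M ->
  (forall N u, N \in M -> u \in N -> size u %| n) -> lcm_len M %| n.
Proof.
move=> ndM dvd_n.
have: all (fun N => necklace_len N %| n) M.
  apply/allP => N NM; have [u uN] := multiset_inhabited ndM NM.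
  by have [_ _ -> _] := mem_multiset ndM NM uN; exact: dvd_n uN.
by elim: (M) => //= N M' IHM /andP[dN /IHM]; rewrite /lcm_len /= dvdn_lcm dN.
Qed.

Lemma lcm_len_gt0 M : is_necklace_multiset M -> 0 < lcm_len M.
Proof.
move=> ndM; have: all (fun N => 0 < necklace_len N) M.
  apply/allP => N NM; have [u uN] := multiset_inhabited ndM NM.
  by have [/primitive_gt0 ? _ -> _] := mem_multiset ndM NM uN.
by elim: (M) => //= N M' IHM /andP[N0 /IHM]; rewrite /lcm_len /= lcmn_gt0 N0.
Qed.

Lemma mem_table M r : reflect
  (exists N u, [/\ N \in M, u \in N & r = wpow u (lcm_len M %/ size u)]) (r \in table M).
Proof.
by rewrite mem_sort; exact: allpairsPdep.
Qed.

Lemma table_sorted M : sorted (@wle k) (table M).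
Proof. exact/sort_sorted/wle_total. Qed.

Lemma exponent_gt0 M N u : is_necklace_multiset M -> N \in M -> u \in N ->
  0 < lcm_len M %/ size u.
Proof.
move=> ndM NM uN; have [/primitive_gt0 u_gt0 _ _ dvd_u] := mem_multiset ndM NM uN.
by rewrite divn_gt0 // dvdn_leq // lcm_len_gt0.
Qed.

Lemma size_table_row M r : is_necklace_multiset M -> r \in table M ->
  size r = lcm_len M.
Proof.
move=> ndM /mem_table[N [u [NM uN ->]]].
by have [_ _ _ dvd_u] := mem_multiset ndM NM uN; rewrite size_wpow divnK.
Qed.

Lemma table_rot M : is_necklace_multiset M ->
  perm_eq (map (rot 1) (table M)) (table M).
Proof.
move=> ndM; rewrite /table; set l := lcm_len M; set rows := flatten _.
apply: perm_trans (perm_map _ (permEl (perm_sort _ rows))) _.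
rewrite perm_sym (perm_trans (permEl (perm_sort _ rows))) // perm_sym /rows.
have: forall N, N \in M -> perm_eq (map (rot 1) N) N.
  by move=> N /ndM[w [_ ->]]; exact: necklace_rot.
(* The row length is generalized to an arbitrary [l], since the lcm changes when a necklace is
   removed. *)
clear ndM rows; move: l; elim: M => //= N M IHM l rotM.
rewrite map_cat perm_cat ?IHM //; last first.
  by move=> N' NM; apply: rotM; rewrite inE NM orbT.
have /(perm_map (fun u => wpow u (l %/ size u))) := rotM N (mem_head _ _).
apply: perm_trans; rewrite -!map_comp.
by rewrite (eq_map (g := (fun u => wpow u (l %/ size u)) \o rot 1)) // => u /=; rewrite rot1_wpow size_rot.
Qed.

Lemma table_iter_rot M r m : is_necklace_multiset M -> r \in table M ->
  iter m (rot 1) r \in table M.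
Proof.
move=> ndM rM; elim: m => //= m IHm.
by rewrite -(perm_mem (table_rot ndM)) map_f.
Qed.

(** A repeated necklace is nonempty and would contribute the same row twice. *)
Lemma table_uniq_multiset M : is_necklace_multiset M -> uniq (table M) -> uniq M.
Proof.
move=> ndM; rewrite sort_uniq; move: (lcm_len M) => l.
elim: M ndM => //= N M IHM ndM; rewrite cat_uniq => /and3P[_ /hasPn disj uM].
have ndM' : is_necklace_multiset M by move=> N' NM; apply: ndM; rewrite inE NM orbT.
rewrite IHM // andbT; apply/negP => NM; have [u uN] := multiset_inhabited ndM' NM.
have uf : wpow u (l %/ size u) \in [seq wpow u (l %/ size u) | u <- N] by exact: map_f.
by move/negP: (disj _ (allpairs_f_dep (fun _ u => wpow u (l %/ size u)) NM uN)); apply.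
Qed.

(** Equal rows have the same primitive root, and the root determines its necklace. *)
Lemma uniq_multiset_table M : is_necklace_multiset M -> uniq M -> uniq (table M).
Proof.
move=> ndM uM; rewrite sort_uniq; apply: allpairs_uniq_dep => //.
  by move=> N /ndM[w [_ ->]]; exact: necklace_uniq.
move=> _ _ /allpairsPdep[N [u [NM uN ->]]] /allpairsPdep[N' [u' [NM' uN' ->]]] /= E.
have [prim_u EN _ _] := mem_multiset ndM NM uN.
have [prim_u' EN' _ _] := mem_multiset ndM NM' uN'.
have Euu : u = u' by apply: primitive_root_uniq E => //; [exact: exponent_gt0 NM uN | exact: exponent_gt0 NM' uN'].
by subst u' N N'.
Qed.

End Tables.

(** * The table whose last column is that of all words; here [n.+1] is the word length *)

Section DeBruijnTable.
Variables (k n : nat) (k_gt1 : 1 < k).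
Local Notation a0 := (Ordinal (ltnW k_gt1)).
Local Notation a1 := (Ordinal k_gt1).
Local Notation word01 := (rcons (nseq n a0) a1).
Implicit Type M : seq (seq (seq 'I_k)).

(** The letter 1 occurs exactly once, while in a [t]-th power its number of occurrences is a
    multiple of [t]. *)
Lemma word01_primitive : primitive word01.
Proof.
move=> [r [t [t_gt1 /(congr1 (count_mem a1))]]].
have -> : count_mem a1 (wpow r t) = t * count_mem a1 r.
  by elim: t {t_gt1} => // t IHt; rewrite wpowS count_cat IHt mulSn.
rewrite -cats1 count_cat count_nseq /= => /esym/eqP.
by rewrite muln_eq1 => /andP[/eqP t1]; rewrite t1 in t_gt1.
Qed.

Lemma table_eq_words M : is_necklace_multiset M ->
  map (last a0) (table M) = map (last a0) (words k n.+1) ->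
  lcm_len M = n.+1 /\ table M = words k n.+1.
Proof.
move=> ndM eqL; set l := lcm_len M; set T := table M in eqL *; set W := words k n.+1 in eqL *.
have sz_T r : r \in T -> size r = l by exact: size_table_row.
have sz_W r : r \in W -> size r = n.+1 by rewrite mem_words => /eqP.
have cols := columns_determined sz_T sz_W (table_rot ndM) (words_rot k n.+1)
  (table_sorted M) (words_sorted k n.+1) eqL.
have take_all (S : seq (seq 'I_k)) d : (forall r, r \in S -> size r = d) -> map (take d) S = S.
  by move=> sz_S; apply: map_id_in => r /sz_S <-; rewrite take_size.
have [le_ln|le_nl] := leqP l n.
  (* Here [T] is [W] cut to [l] columns, so the last letter of every word of [W] is also the last
     letter of its prefix of length [l]. For [word01] that prefix consists of zeros only. *)
  have := eqL; rewrite -(take_all T l sz_T) (cols l) ?leqW // -map_comp => /eq_in_map eq_last.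
  have /eq_last : word01 \in W by rewrite mem_words size_rcons size_nseq.
  rewrite last_rcons /= -cats1 takel_cat ?size_nseq // take_nseq //.
  by have -> : last a0 (nseq l a0) = a0 by elim: (l).
have eqTW : map (take n.+1) T = W by rewrite cols // take_all.
have last_T r : r \in T -> nth a0 r n = nth a0 r l.-1.
  move=> rT; have := eqL; rewrite -eqTW -map_comp => /eq_in_map/(_ r rT) /=.
  have sz_r := sz_T r rT.
  by rewrite -!nth_last size_takel sz_r // nth_take // => ->.
have period r : r \in T -> iter n.+1 (rot 1) r = r.
  move=> rT; have sz_r := sz_T r rT; apply: (@eq_from_nth _ a0); rewrite size_iter_rot //.
  (* In the row rotated by [j.+1], position [n] holds the letter of [r] at [j + n.+1] modulo [l],
     and position [l.-1] holds the letter at [j]. *)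
  move=> j lt_jr; have := last_T _ (table_iter_rot j.+1 ndM rT).
  have l_gt0 : 0 < l by rewrite lcm_len_gt0.
  rewrite !nth_iter_rot ?sz_r ?prednK // -?sz_r // sz_r.
  rewrite [n + _]addnC addSnnS => ->.
  by rewrite addnS -addSn prednK // modnDl modn_small // -sz_r.
have dvd_l : l %| n.+1.
  apply: lcm_len_dvdn => // N u NM uN; have [prim_u _ _ _] := mem_multiset ndM NM uN.
  apply: (primitive_dvdn_wpow prim_u (exponent_gt0 ndM NM uN)); apply: period.
  by apply/mem_table; exists N, u.
have eq_l : l = n.+1 by apply/eqP; rewrite eqn_leq dvdn_leq.
by split=> //; rewrite -eqTW -eq_l take_all.
Qed.

Lemma BW_last M : is_necklace_multiset M -> BW M = map (last a0) (table M).
Proof.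
move=> ndM; apply: flatten_last => r rM.
by rewrite (size_table_row ndM rM) lcm_len_gt0.
Qed.

(** Existence is shown by construction: take the necklaces of the roots of all words of length
    [n.+1], each once. The table and the list of words are then sorted and duplicate-free with the
    same elements. *)
Lemma words_multiset_exists :
  exists M, is_necklace_multiset M /\ table M = words k n.+1.
Proof.
pose M : seq (seq (seq 'I_k)) := undup [seq necklace (wroot r) | r <- words k n.+1].
have rootP (r : seq 'I_k) : r \in words k n.+1 -> [/\ size r = n.+1, 0 < size (wroot r),
    size (wroot r) %| n.+1, r = wpow (wroot r) (n.+1 %/ size (wroot r)) & primitive (wroot r)].
  rewrite mem_words => /eqP sz_r; have r_gt0 : 0 < size r by rewrite sz_r.
  by have := wroot_spec r_gt0; rewrite sz_r => -[].
have memM r : r \in words k n.+1 -> necklace (wroot r) \in M.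
  by move=> rW; rewrite mem_undup (map_f (fun r => necklace (wroot r))).
have ndM : is_necklace_multiset M.
  move=> N; rewrite mem_undup => /mapP[r /rootP[_ _ _ _ prim_r] ->].
  by exists (wroot r).
have dvd_M : lcm_len M %| n.+1.
  apply: lcm_len_dvdn => // N u; rewrite mem_undup => /mapP[r /rootP[_ r_gt0 dvd_r _ _] ->].
  by move/(size_mem_necklace r_gt0) ->.
have eq_l : lcm_len M = n.+1.
  apply/eqP; rewrite eqn_dvd dvd_M /=.
  (* [word01] is primitive, hence its own root, so a necklace of length exactly [n.+1] occurs in
     [M]. *)
  have wW : word01 \in words k n.+1 by rewrite mem_words size_rcons size_nseq.
  have [_ gt0 _ _ _] := rootP _ wW.
  have [_ _ _] := mem_multiset ndM (memM _ wW) (necklace_id gt0).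
  by rewrite -{1}(wpow1 word01) (wroot_wpow word01_primitive) // size_rcons size_nseq.
exists M; split=> //.
apply: wsorted_perm_eq; [exact: table_sorted | exact: words_sorted |].
apply: uniq_perm; [exact: uniq_multiset_table (undup_uniq _) | exact: words_uniq |].
move=> r; apply/idP/idP => [rM|rW].
  by rewrite mem_words (size_table_row ndM rM) eq_l.
have [_ gt0 _ Er _] := rootP _ rW.
by apply/mem_table; exists (necklace (wroot r)), (wroot r); rewrite memM // necklace_id // eq_l.
Qed.

End DeBruijnTable.

Theorem theorem3p8 (k n : nat) (hk : 2 <= k) (hn : 1 <= n) :
  let v := wpow (alpha k) (k ^ (n - 1)) in
  (exists M : seq (seq (seq 'I_k)), is_necklace_multiset M /\ BW M = v) /\
  (forall M : seq (seq (seq 'I_k)), is_necklace_multiset M -> BW M = v ->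
     [/\ (forall r, r \in table M -> size r = n),
         [seq map val r | r <- table M] = [seq digits k n i | i <- iota 0 (k ^ n)],
         uniq M /\
         (forall N, N \in M <->
            exists w : seq 'I_k, [/\ lyndon w, size w %| n & N = necklace w]) &
         (forall i j, i < j < size (table M) ->
            lyndon (wroot (nth [::] (table M) i)) ->
            lyndon (wroot (nth [::] (table M) j)) ->
            wlt (wroot (nth [::] (table M) i)) (wroot (nth [::] (table M) j)))]).
Proof.
case: n hn => // n _ v; have Ev : v = map (last (Ordinal (ltnW hk))) (words k n.+1).
  by rewrite map_last_words /v subn1.
split=> [|M ndM].
  have [M [ndM EM]] := words_multiset_exists n hk.
  by exists M; split=> //; rewrite (BW_last hk) // EM -Ev.
rewrite (BW_last hk ndM) Ev => /(table_eq_words ndM)[eq_l eqT].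
have uT : uniq (table M) by rewrite eqT words_uniq.
split.
- by move=> r /(size_table_row ndM) ->.
- by rewrite eqT map_val_words.
- split=> [|N]; first exact: table_uniq_multiset.
  split=> [NM|[w [[prim_w _] dvd_w ->]]].
    have [w [prim_w EN]] := ndM N NM; have w_gt0 := primitive_gt0 prim_w.
    have [u uw lyn_u] := lyndon_conjugate prim_w; exists u; split=> //.
      by have [] := mem_multiset (u := u) ndM NM; rewrite ?EN // eq_l.
    by rewrite (necklace_eq w_gt0 uw).
  (* Every word of length [n.+1] is a row, in particular this power of [w]. It comes from some [u]
     in a necklace of [M], and uniqueness of primitive roots gives [w = u]. *)
  have : wpow w (n.+1 %/ size w) \in table M by rewrite eqT mem_words size_wpow divnK.
  case/mem_table=> {}N [u [NM uN E]].
  have [prim_u EN _ _] := mem_multiset ndM NM uN.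
  suff -> : w = u by rewrite -EN.
  apply: primitive_root_uniq E => //; last exact: exponent_gt0 NM uN.
  by rewrite divn_gt0 ?primitive_gt0 // dvdn_leq.
- move=> i j /andP[lt_ij lt_j]; have lt_i := ltn_trans lt_ij lt_j.
  (* The rows are sorted and distinct, hence strictly increasing; the comparison passes to the roots
     because all rows have the same length. *)
  have lt_rows : wlt (nth [::] (table M) i) (nth [::] (table M) j).
    rewrite /wlt nth_uniq // ltn_eqF // andbT.
    exact: (sorted_ltn_nth (@wle_trans k) [::] (table_sorted M)).
  move: lt_rows (mem_nth [::] lt_i) (mem_nth [::] lt_j).
  move: (nth _ _ i) (nth _ _ j) => r s lt_rs.
  rewrite eqT !mem_words => /eqP sz_r /eqP sz_s.
  have r_gt0 : 0 < size r by rewrite sz_r.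
  have s_gt0 : 0 < size s by rewrite sz_s.
  have [u_gt0 dvd_u Er _] := wroot_spec r_gt0; have [_ _ Es _] := wroot_spec s_gt0.
  have t_gt0 : 0 < size r %/ size (wroot r) by rewrite divn_gt0 // dvdn_leq.
  move=> lyn_r lyn_s.
  apply: (lyndon_wpow_lt (t := (size r %/ size (wroot r)).-1)
           (s := size s %/ size (wroot s)) lyn_r lyn_s).
    by rewrite prednK // -Er -Es sz_r sz_s.
  by rewrite prednK // -Er -Es.
Qed.
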